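(* Let $\{x_k\}_{k\ge0}$, $\{\bar x_{k+1}\}_{k\ge0}$, $\{\alpha_k\}_{k\ge0}$ be generated by the inexact SQA algorithm described in the context with any one of the line searches LS1, LS2, LS3, LS4. Then there is a constant $c_1>0$ (independent of $k$) such that for all $k\ge0$ $$F(x_{k+1})-F(x_k)\le-\alpha_kc_1\|\bar x_{k+1}-x_k\|_k^2.$$ Thus $\{F(x_k)\}$ is monotone decreasing (i.e. nonincreasing) and $\sum_{k=0}^{+\infty}\alpha_k\|\bar x_{k+1}-x_k\|^2<+\infty$.
   Context: Setting. $\mathcal{H}$ is a real Hilbert space with norm $\|\cdot\|$ and inner product $\langle\cdot,\cdot\rangle$. $F:=f+g$, where $f,g:\mathcal{H}\to(-\infty,\infty]$ are proper lower semicontinuous convex functions with $\operatorname{dom} g\subset\operatorname{int}(\operatorname{dom} f)$ (so $\operatorname{dom}F=\operatorname{dom}g$). $f$ is Fréchet differentiable on an open set containing $\operatorname{dom} g$, and $\nabla f$ is continuous on $\operatorname{dom} g$. The set $\mathcal{X}$ of minimizers of $F$ is nonempty and $F^\ast:=\min F\in\mathbb{R}$. Metrics. $H_k:\mathcal{H}\to\mathcal{H}$ ($k\ge0$) are positive self-adjoint operators, $\langle\cdot,\cdot\rangle_k=\langle\cdot,H_k\cdot\rangle$ are inner products with induced norms $\|\cdot\|_k$, and there are constants $m,M>0$ with $m\|\cdot\|^2\le\|\cdot\|_k^2\le M\|\cdot\|^2$ for all $k\ge0$. Algorithm (inexact SQA). Fix $\eta\in(0,1]$, $x_0\in\operatorname{dom}F$,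 and one of the line searches below. For $k=0,1,2,\dots$, let $Q_k(x):=\langle\nabla f(x_k),x-x_k\rangle+g(x)-g(x_k)+\frac12\|x-x_k\|_k^2$ and $Q_k^\ast:=\min_{x\in\mathcal{H}}Q_k(x)$. Choose any $\bar x_{k+1}$ with $Q_k(\bar x_{k+1})\le\eta\,(Q_k^\ast-Q_k(x_k))$ (note $Q_k(x_k)=0$), put $d_k:=\bar x_{k+1}-x_k$, determine $\alpha_k$ by the line search, and set $x_{k+1}:=x_k+\alpha_k d_k$. Line searches. In each case $\beta\in(0,1)$, $\bar\alpha\in(0,1]$, and $\alpha_k$ is the largest $\alpha\in\{\bar\alpha\beta^i: i=0,1,2,\dots\}$ satisfying: LS1 ($\gamma\in(0,1)$): $F(x_k+\alpha d_k)-F(x_k)\le\gamma\alpha\big(\langle\nabla f(x_k),d_k\rangle+g(\bar x_{k+1})-g(x_k)\big)$. LS2 ($\gamma\in(0,m/2)$): $\alpha\|\nabla f(x_k+\alpha d_k)-\nabla f(x_k)\|\le\gamma\|\alpha d_k\|$. LS3 ($\gamma\in(0,1)$): $F(x_k+\alpha d_k)-F(x_k)\le\alpha\big(\langle\nabla f(x_k),d_k\rangle+g(\bar x_{k+1})-g(x_k)+\frac{\gamma}{2}\|d_k\|_k^2\big)$. LS4 ($\gamma\in(0,1)$): $f(x_k+\alpha d_k)-f(x_k)\le\alpha\big(\langle\nabla f(x_k),d_k\rangle+\frac{\gamma}{2}\|d_k\|_k^2\big)$. *)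

(* Defs.v *)
From HB Require Import structures.
From mathcomp Require Import all_boot all_order all_algebra sesquilinear.
From mathcomp Require Import all_classical all_reals all_analysis.

Set Implicit Arguments.
Unset Strict Implicit.
Unset Printing Implicit Defensive.

Import Order.TTheory GRing.Theory Num.Theory.
Import numFieldNormedType.Exports.

Local Open Scope classical_set_scope.
Local Open Scope ring_scope.

Section extended_real_functions.
Context {R : realType} {H : normedModType R}.
Implicit Types h : H -> \bar R.

Definition edom h : set H := [set x | (h x < +oo)%E].

Definition proper_fun h : Prop := (forall x, (-oo < h x)%E) /\ edom h !=set0.

(* The weights are strictly positive, so 0 * +oo never occurs; for proper h
   neither does +oo - oo. *)
Definition econvex h : Prop := forall (t : R) (x y : H), 0 < t -> t < 1 ->
  (h (t *: x + (1 - t) *: y)%R <= t%:E * h x + (1 - t)%R%:E * h y)%E.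

Definition is_min h (v : \bar R) : Prop :=
  (exists x, h x = v) /\ forall y, (v <= h y)%E.

End extended_real_functions.

Section hilbert.
Context {R : realType} {H : normedModType R}.
Variable dot : {dot H for idfun}.

(* u is the Riesz representative of the Frechet derivative of h at x. When h
   takes the value +oo, this is meaningful only for x in the interior of
   edom h, where [fine \o h] agrees with h near x. *)
Definition is_gradient (h : H -> \bar R) (x u : H) : Prop :=
  differentiable (fine \o h) x /\ forall v, 'd (fine \o h) x v = dot u v.

Definition self_adjoint (A : {linear H -> H}) : Prop :=
  forall x y, dot (A x) y = dot x (A y).

Definition positive_op (A : {linear H -> H}) : Prop :=
  forall x, x != 0 -> 0 < dot x (A x).

Definition norm_op (A : {linear H -> H}) (x : H) : R := Num.sqrt (dot x (A x)).

End hilbert.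

Inductive line_search := LS1 | LS2 | LS3 | LS4.

Definition gamma_range {R : realType} (ls : line_search) (m gamma : R) : Prop :=
  match ls with
  | LS2 => 0 < gamma < m / 2
  | _ => 0 < gamma < 1
  end.

Section algorithm.
Context {R : realType} {H : normedModType R}.
Variables (dot : {dot H for idfun}) (f g : H -> \bar R) (gradf : H -> H).

Definition sqa_model (A : {linear H -> H}) (xk x : H) : \bar R :=
  ((dot (gradf xk) (x - xk))%:E + g x - g xk
   + (2^-1 * norm_op dot A (x - xk) ^+ 2)%:E)%E.

Definition ls_cond (ls : line_search) (A : {linear H -> H}) (gamma : R)
    (xk xbar : H) (a : R) : Prop :=
  let d := xbar - xk in
  let F := (f \+ g)%E in
  match ls with
  | LS1 => (F (xk + a *: d)%R - F xk
            <= (gamma * a)%:E * ((dot (gradf xk) d)%:E + g xbar - g xk))%E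
  | LS2 => a * `|gradf (xk + a *: d) - gradf xk| <= gamma * `|a *: d|
  | LS3 => (F (xk + a *: d)%R - F xk
            <= a%:E * ((dot (gradf xk) d)%:E + g xbar - g xk
                       + (gamma / 2 * norm_op dot A d ^+ 2)%:E))%E
  | LS4 => (f (xk + a *: d)%R - f xk
            <= a%:E * ((dot (gradf xk) d)%:E
                       + (gamma / 2 * norm_op dot A d ^+ 2)%:E))%E
  end.

Definition largest_in_grid (abar beta : R) (P : R -> Prop) (a : R) : Prop :=
  [/\ exists i : nat, a = abar * beta ^+ i, P a &
      forall i : nat, P (abar * beta ^+ i) -> abar * beta ^+ i <= a].

(* [xbar 0] is unconstrained: the trial points are xbar 1, xbar 2, etc *)
Definition inexact_sqa (ls : line_search) (Hk : nat -> {linear H -> H})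
    (eta gamma beta abar : R) (x xbar : nat -> H) (alpha : nat -> R) : Prop :=
  edom (f \+ g)%E (x 0%N) /\
  forall k : nat,
    [/\ exists2 Qstar : \bar R, is_min (sqa_model (Hk k) (x k)) Qstar &
          (sqa_model (Hk k) (x k) (xbar k.+1)
           <= eta%:E * (Qstar - sqa_model (Hk k) (x k) (x k)))%E,
        largest_in_grid abar beta
          (ls_cond ls (Hk k) gamma (x k) (xbar k.+1)) (alpha k) &
        x k.+1 = x k + alpha k *: (xbar k.+1 - x k)].

End algorithm.

(* Main.v *)
Require Import Defs.
From HB Require Import structures.
From mathcomp Require Import all_boot all_order all_algebra sesquilinear.
From mathcomp Require Import all_classical all_reals all_analysis.
From mathcomp Require Import lra.

Import Order.TTheory GRing.Theory Num.Theory.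
Import numFieldNormedType.Exports.

Local Open Scope classical_set_scope.
Local Open Scope ring_scope.

Set Implicit Arguments.
Unset Strict Implicit.

(** Write [N_k] for the squared [H_k]-norm of [d_k = xbar_(k+1) - x_k] and
    [D_k = <gradf x_k, d_k> + g xbar_(k+1) - g x_k] for the predicted decrease.
    The model [Q_k] vanishes at [x_k], so its minimum is nonpositive, and the
    inexactness criterion makes [Q_k xbar_(k+1)] nonpositive too; this says that
    [D_k <= - N_k / 2] ([sqa_model_decrease]).

    Each line search turns this into a decrease of [F] proportional to
    [alpha_k N_k] ([line_search_decrease]).  The acceptance test bounds
    [F x_(k+1) - F x_k] by [gamma alpha_k D_k] for LS1, and by
    [alpha_k (D_k + gamma N_k / 2)] for LS3.  LS4 tests [f] alone, and convexity of [g]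
    on the segment from [x_k] to [xbar_(k+1)] supplies the missing part
    [alpha_k (g xbar_(k+1) - g x_k)].  For LS2 the bound on [f] comes from the
    gradient inequality at the new point: [f x_(k+1) - f x_k] is at most
    [alpha_k <gradf x_(k+1), d_k>], and replacing [gradf x_(k+1)] by [gradf x_k]
    costs at most [alpha_k gamma |d_k|^2 <= alpha_k (gamma / m) N_k], by
    Cauchy-Schwarz and the test ([gradient_increment_le]).  The condition
    [gamma < m / 2] is exactly what keeps [1/2 - gamma / m] positive.

    All these quantities are finite because every iterate stays in the domain of
    [g]: this domain is convex, it contains [xbar_(k+1)] because the model is
    nonpositive there, and the step lies in (0, 1].  Summability follows by telescoping, as [F] is
    bounded below by its minimum. *)

(** * Cauchy-Schwarz, and convex functions along segments *)

(** Cauchy-Schwarz, from the nonnegativity of the square of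
    [`|v| *: u - `|u| *: v], which equals
    [2 `|u| `|v| (`|u| `|v| - dot u v)]. *)
Lemma dot_le_norm (R : realType) (H : normedModType R) (dot : {dot H for idfun})
    (hdot : forall x : H, `|x| ^+ 2 = dot x x) (u v : H) :
  dot u v <= `|u| * `|v|.
Proof.
have [->|u0] := eqVneq u 0; first by rewrite normr0 mul0r linear0l.
have [->|v0] := eqVneq v 0; first by rewrite normr0 mulr0 linear0r.
have uv_gt0 : 0 < `|u| * `|v| by rewrite mulr_gt0// normr_gt0.
have dotC : dot v u = dot u v by rewrite hermC /= expr0 mul1r.
have : 0 <= `| `|v| *: u - `|u| *: v | ^+ 2 by rewrite sqr_ge0.
rewrite hdot !(linearBl, linearBr, linearZl_LR, linearZr_LR)/= dotC -!hdot.
by rewrite -(ler_pM2l uv_gt0) /GRing.scale/= => ?; nra.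
Qed.

Section proper_convex.
Context {R : realType} {H : normedModType R} (h : H -> \bar R).
Hypotheses (h_proper : proper_fun h) (h_convex : econvex h).

Lemma proper_fin_num {x : H} : edom h x -> h x \is a fin_num.
Proof. by move=> hx; rewrite fin_numElt h_proper.1. Qed.

(** The step [a = 1] is admissible in the line searches but excluded from
    [econvex], whence the separate, trivial case. *)
Lemma econvex_segment {x y : H} {a : R} : 0 < a <= 1 ->
  edom h x -> edom h y ->
  edom h (x + a *: (y - x)) /\
  fine (h (x + a *: (y - x))) - fine (h x) <= a * (fine (h y) - fine (h x)).
Proof.
move=> /andP[a0]; rewrite le_eqVlt => /predU1P[->|a1] hx hy.
  by rewrite scale1r addrC subrK mul1r.
have hc := h_convex y x a0 a1.
have -> : x + a *: (y - x) = a *: y + (1 - a) *: x.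
  by rewrite scalerBr scalerBl scale1r addrCA addrA.
move: hc; rewrite -(fineK (proper_fin_num hx)) -(fineK (proper_fin_num hy)).
rewrite -!EFinM -EFinD => hc.
have hz : edom h (a *: y + (1 - a) *: x).
  exact: le_lt_trans hc (ltry _).
split=> //; move: hc; rewrite -(fineK (proper_fin_num hz)) lee_fin /=.
lra.
Qed.

(** The difference quotients of a convex function along a segment are bounded by
    its increment over the whole segment; the one-sided limit at [0] is the
    directional derivative. *)
Lemma gradient_le (dot : {dot H for idfun}) (x y u : H) :
  edom h x -> edom h y -> is_gradient dot h x u ->
  dot u (y - x) <= fine (h y) - fine (h x).
Proof.
move=> hx hy [dx gradE]; rewrite -gradE -deriveE//.
have cvg0 := @diff_derivable _ _ _ _ _ (y - x) dx.
have cvgr : (fun t : R => t^-1 *: ((fine \o h \o shift x) (t *: (y - x))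
    - (fine \o h) x)) @ 0^'+ --> 'D_(y - x) (fine \o h) x.
  exact: cvg_dnbhs_at_right cvg0.
apply: (cvgr_to_le cvgr).
near=> t.
have t01 : 0 < t <= 1.
  by apply/andP; split; near: t; [exact: nbhs_right_gt | exact: nbhs_right_le].
have [_] := econvex_segment t01 hx hy.
rewrite /= (addrC x) => ht; rewrite /GRing.scale/=.
by case/andP: t01 => t0 _; rewrite ler_pdivrMl//.
Unshelve. all: by end_near. Qed.

End proper_convex.

(** * Summability by telescoping *)

Lemma nneseries_telescope_lty (R : realType) (a u : nat -> R) (c L : R) :
  0 < c -> (forall k, 0 <= a k) -> (forall k, L <= u k) ->
  (forall k, c * a k <= u k - u k.+1) ->
  (\sum_(0 <= k <oo) (a k)%:E < +oo)%E.
Proof.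
move=> c0 a0 uL au.
apply: (@le_lt_trans _ _ (((u 0%N - L) / c)%:E)); last exact: ltry.
apply: lime_le; first by apply: is_cvg_nneseries => k _ _; rewrite lee_fin.
near=> n; rewrite sumEFin lee_fin ler_pdivlMr// mulrC mulr_sumr.
apply: (@le_trans _ _ (\sum_(0 <= k < n) (u k - u k.+1))).
  exact: ler_sum.
under eq_bigr do rewrite -opprB.
by rewrite sumrN telescope_sumr// opprB lerD2l lerN2.
Unshelve. all: by end_near. Qed.

(** * Decrease predicted by the quadratic model *)

(** The model vanishes at [xk], so its minimum is nonpositive and a positive
    fraction [eta] of it still is: the trial point has nonpositive model value. *)
Lemma sqa_model_decrease (R : realType) (H : normedModType R)
    (dot : {dot H for idfun}) (g : H -> \bar R) (gradf : H -> H)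
    (A : {linear H -> H}) (eta : R) (xk xb : H) :
  0 < eta -> proper_fun g -> edom g xk ->
  (exists2 Qstar : \bar R, is_min (sqa_model dot g gradf A xk) Qstar &
    (sqa_model dot g gradf A xk xb
     <= eta%:E * (Qstar - sqa_model dot g gradf A xk xk))%E) ->
  edom g xb /\
  dot (gradf xk) (xb - xk) + fine (g xb) - fine (g xk)
    <= - (norm_op dot A (xb - xk) ^+ 2 / 2).
Proof.
move=> eta0 g_proper gxk [Qstar [_ Qmin] Qxb].
have gk := proper_fin_num g_proper gxk.
have Qxk0 : sqa_model dot g gradf A xk xk = 0%E.
  rewrite /sqa_model /norm_op subrr !linear0r linear0l sqrtr0 expr0n /= mulr0.
  by rewrite add0e subee// adde0.
have Qxb0 : (sqa_model dot g gradf A xk xb <= 0)%E.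
  apply: le_trans Qxb _; rewrite Qxk0 sube0 pmule_rle0 ?lte_fin//.
  by rewrite -Qxk0.
have gxb : edom g xb.
  rewrite /edom /= ltey; apply/eqP => gy; move: Qxb0.
  by rewrite /sqa_model gy -(fineK gk).
split=> //; move: Qxb0; rewrite /sqa_model.
rewrite -(fineK gk) -(fineK (proper_fin_num g_proper gxb)).
rewrite -!(EFinN, EFinD) lee_fin /=; lra.
Qed.

(** * Decrease achieved by the line searches *)

(** The model predicts a decrease of at least half the squared metric norm of the
    direction. LS1 keeps the fraction [gamma] of it; the other line searches
    lose an error term, [gamma / 2] or, after comparing the two norms through
    [m], [gamma / m]. *)
Definition decrease_const {R : realType} (ls : line_search) (m gamma : R) : R :=
  match ls with
  | LS1 => gamma / 2
  | LS2 => 2^-1 - gamma / m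
  | LS3 | LS4 => (1 - gamma) / 2
  end.

Lemma decrease_const_gt0 (R : realType) (ls : line_search) (m gamma : R) :
  0 < m -> gamma_range ls m gamma -> 0 < decrease_const ls m gamma.
Proof.
move=> m0; case: ls => /= /andP[g0 g1]; try lra.
by rewrite subr_gt0 ltr_pdivrMr// mulrC.
Qed.

Section line_search_decrease.
Context {R : realType} {H : normedModType R} (dot : {dot H for idfun}).
Hypothesis hdot : forall x : H, `|x| ^+ 2 = dot x x.
Variables (f g : H -> \bar R) (gradf : H -> H) (U : set H).
Hypotheses (f_proper : proper_fun f) (f_convex : econvex f).
Hypotheses (g_proper : proper_fun g) (g_convex : econvex g).
Hypotheses (gU : edom g `<=` U) (Uf : U `<=` edom f).
Hypothesis f_grad : forall x, U x -> is_gradient dot f x (gradf x).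

Lemma sum_fin x : edom g x -> (f x + g x = (fine (f x) + fine (g x))%:E)%E.
Proof.
move=> gx; rewrite EFinD !fineK//; apply: proper_fin_num => //.
by apply/Uf/gU.
Qed.

(** Evaluating the gradient inequality at the new point, not at [x], gives an
    upper bound on the increase of [f]; the line search test then controls
    the change of gradient between the two points. *)
Lemma gradient_increment_le (A : {linear H -> H}) (m gamma a : R) (x d : H) :
  0 < m -> 0 <= gamma -> 0 < a ->
  m * `|d| ^+ 2 <= norm_op dot A d ^+ 2 ->
  edom g x -> edom g (x + a *: d) ->
  a * `|gradf (x + a *: d) - gradf x| <= gamma * `|a *: d| ->
  fine (f (x + a *: d)) - fine (f x)
    <= a * (dot (gradf x) d + gamma / m * norm_op dot A d ^+ 2).
Proof.
move=> m0 gamma0 a0 Ad gx gz lip.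
set z := x + a *: d.
have := gradient_le f_proper f_convex (Uf (gU gz)) (Uf (gU gx))
  (f_grad (gU gz)).
rewrite -/z (_ : x - z = - (a *: d)); last by rewrite /z opprD addrA subrr add0r.
rewrite linearNr linearZr_LR /= => fz.
have cs := dot_le_norm hdot (gradf z - gradf x) d.
have {}lip : `|gradf z - gradf x| <= gamma * `|d|.
  by rewrite -(ler_pM2l a0) (le_trans lip)// normrZ gtr0_norm// mulrCA.
have {}cs : dot (gradf z) d - dot (gradf x) d <= gamma * `|d| ^+ 2.
  rewrite -linearBl (le_trans cs)// expr2 mulrA.
  exact: ler_wpM2r.
have {}Ad : gamma * `|d| ^+ 2 <= gamma / m * norm_op dot A d ^+ 2.
  by rewrite -mulrA ler_wpM2l// ler_pdivlMl.
have : a * dot (gradf z) d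
    <= a * (dot (gradf x) d + gamma / m * norm_op dot A d ^+ 2).
  by rewrite ler_pM2l//; lra.
by move: fz; rewrite /GRing.scale /=; lra.
Qed.

(** LS1 and LS3 test the whole objective; LS2 and LS4 control [f] alone, and
    convexity of [g] along the search segment accounts for the rest. *)
Lemma line_search_decrease (ls : line_search) (A : {linear H -> H})
    (m gamma a : R) (xk xb : H) :
  0 < m -> gamma_range ls m gamma -> 0 < a <= 1 ->
  m * `|xb - xk| ^+ 2 <= norm_op dot A (xb - xk) ^+ 2 ->
  edom g xk -> edom g xb ->
  dot (gradf xk) (xb - xk) + fine (g xb) - fine (g xk)
    <= - (norm_op dot A (xb - xk) ^+ 2 / 2) ->
  ls_cond dot f g gradf ls A gamma xk xb a ->
  fine (f (xk + a *: (xb - xk))) + fine (g (xk + a *: (xb - xk)))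
      - (fine (f xk) + fine (g xk))
    <= - (a * decrease_const ls m gamma * norm_op dot A (xb - xk) ^+ 2).
Proof.
move=> m0 gamma_rg a01; set d := xb - xk; set z := xk + a *: d.
set N := norm_op dot A d ^+ 2; set D := dot (gradf xk) d.
move=> Ad gk gb model lscond.
have [gz gconv] : edom g z /\
    fine (g z) - fine (g xk) <= a * (fine (g xb) - fine (g xk)).
  exact: econvex_segment.
have a0 : 0 < a by case/andP: a01.
have gK x : edom g x -> g x = (fine (g x))%:E.
  by move=> gx; rewrite fineK// proper_fin_num.
have fK x : edom g x -> f x = (fine (f x))%:E.
  by move=> gx; rewrite fineK// proper_fin_num//; apply/Uf/gU.
move: model lscond gconv; rewrite -/d -/z.
move=> /(ler_wpM2l (ltW a0)) model.
case: ls gamma_rg => /= gamma_rg.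
- rewrite -/d -/z (gK xk)// (gK xb)// (gK z)// (fK xk)// (fK z)//.
  rewrite -!(EFinN, EFinD, EFinM) lee_fin -/D => lsc _.
  case/andP: gamma_rg => /ltW gamma0 _.
  by move: model => /(ler_wpM2l gamma0); lra.
- rewrite -/d => lsc gconv.
  case/andP: gamma_rg => /ltW gamma0 _.
  have := gradient_increment_le m0 gamma0 a0 Ad gk gz lsc.
  by rewrite -/D -/N -/z; lra.
- rewrite -/d -/z (gK xk)// (gK xb)// (gK z)// (fK xk)// (fK z)//.
  rewrite -/D -/N -!(EFinN, EFinD, EFinM) lee_fin => lsc _.
  by move: model lsc; lra.
- rewrite -/d -/z (fK xk)// (fK z)//.
  rewrite -/D -/N -!(EFinN, EFinD, EFinM) lee_fin => lsc gconv.
  by move: model lsc gconv; lra.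
Qed.

End line_search_decrease.

Unset Implicit Arguments.
Set Strict Implicit.

(** * Sufficient decrease and summability *)

Theorem lemma3 (R : realType) (H : completeNormedModType R)
  (dot : {dot H for idfun})
  (hdot : forall x : H, `|x| ^+ 2 = dot x x)
  (f g : H -> \bar R)
  (f_proper : proper_fun f) (f_lsc : lower_semicontinuous f) (f_convex : econvex f)
  (g_proper : proper_fun g) (g_lsc : lower_semicontinuous g) (g_convex : econvex g)
  (dom_gf : edom g `<=` interior (edom f))
  (gradf : H -> H)
  (f_diff : exists U : set H,
    [/\ open U, edom g `<=` U, U `<=` edom f &
        forall x, U x -> is_gradient dot f x (gradf x)])
  (gradf_cont : {within edom g, continuous gradf})
  (Fstar : R) (F_min : is_min (f \+ g)%E Fstar%:E)
  (Hk : nat -> {linear H -> H})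
  (Hk_sa : forall k, self_adjoint dot (Hk k))
  (Hk_pos : forall k, positive_op dot (Hk k))
  (m M : R) (m_gt0 : 0 < m) (M_gt0 : 0 < M)
  (Hk_bounds : forall k x,
    m * `|x| ^+ 2 <= norm_op dot (Hk k) x ^+ 2 <= M * `|x| ^+ 2)
  (ls : line_search) (eta gamma beta abar : R)
  (eta_range : 0 < eta <= 1)
  (gamma_rg : gamma_range ls m gamma)
  (beta_range : 0 < beta < 1)
  (abar_range : 0 < abar <= 1)
  (x xbar : nat -> H) (alpha : nat -> R)
  (sqa : inexact_sqa dot f g gradf ls Hk eta gamma beta abar x xbar alpha) :
  let F := (f \+ g)%E in
  [/\ exists2 c1 : R, 0 < c1 & forall k : nat,
        (F (x k.+1) - F (x k)
         <= (- (alpha k * c1 * norm_op dot (Hk k) (xbar k.+1 - x k)%R ^+ 2))%:E)%E,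
      nonincreasing_seq (fun k => F (x k)) &
      (\sum_(0 <= k <oo) (alpha k * `|xbar k.+1 - x k| ^+ 2)%:E < +oo)%E].
Proof.
move=> F.
have [U [_ gU Uf f_grad]] := f_diff.
have [eta0 _] := andP eta_range.
have [x0_dom step] := sqa.
have alpha01 k : 0 < alpha k <= 1.
  have [_ [[i ->] _ _] _] := step k.
  case/andP: beta_range => b0 b1; case/andP: abar_range => a0 a1.
  rewrite mulr_gt0 ?exprn_gt0//= mulr_ile1 ?exprn_ge0 ?(ltW a0) ?(ltW b0)//.
  by rewrite exprn_ile1 ?(ltW b0) ?(ltW b1).
have xbar_dom k : edom g (x k) -> edom g (xbar k.+1).
  move=> gx; have [model _ _] := step k.
  by have [] := sqa_model_decrease eta0 g_proper gx model.
have x_dom k : edom g (x k).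
  elim: k => [|k gx].
    (* f never takes the value -oo, so F x0 < +oo forces g x0 < +oo *)
    move: x0_dom; rewrite /edom /= !ltey; apply: contra => /eqP ->.
    by rewrite addey// gt_eqF// f_proper.1.
  have [_ _ ->] := step k.
  by have [] := econvex_segment g_proper g_convex (alpha01 k) gx (xbar_dom k gx).
pose Fr k := fine (f (x k)) + fine (g (x k)).
have FE k : F (x k) = (Fr k)%:E := sum_fin f_proper g_proper gU Uf (x_dom k).
pose c := decrease_const ls m gamma.
have c0 : 0 < c := decrease_const_gt0 m_gt0 gamma_rg.
have descent k : Fr k.+1 - Fr k
    <= - (alpha k * c * norm_op dot (Hk k) (xbar k.+1 - x k) ^+ 2).
  have [model [_ lsc _] xS] := step k.
  have [_ dec] := sqa_model_decrease eta0 g_proper (x_dom k) model.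
  rewrite /Fr xS; apply: (line_search_decrease hdot f_proper f_convex g_proper
    g_convex gU Uf f_grad m_gt0) => //.
    by case/andP: (Hk_bounds k (xbar k.+1 - x k)).
  exact: xbar_dom.
split.
- by exists c => // k; rewrite !FE -EFinB lee_fin.
- apply/nonincreasing_seqP => k; rewrite !FE lee_fin -subr_le0.
  apply: le_trans (descent k) _; have [a0 _] := andP (alpha01 k).
  by rewrite oppr_le0 mulr_ge0 ?sqr_ge0// mulr_ge0 ?ltW.
- apply: (nneseries_telescope_lty (u := Fr) (c := c * m) (L := Fstar)).
  + exact: mulr_gt0.
  + by move=> k; have [a0 _] := andP (alpha01 k); rewrite mulr_ge0 ?sqr_ge0 ?ltW.
  + by move=> k; rewrite -lee_fin -FE; exact: F_min.2.
  + move=> k; rewrite -lerN2 opprB; apply: le_trans (descent k) _.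
    (* passing from the H_k-norm to the norm of H costs the factor m *)
    have [a0 _] := andP (alpha01 k).
    have [mN _] := andP (Hk_bounds k (xbar k.+1 - x k)).
    rewrite lerN2 mulrACA (mulrC c) ler_wpM2l//.
    by rewrite mulr_ge0 ?ltW.
Qed.
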